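(* Each of the permutation statistics $\operatorname{lpk}$ (left peak number), $\operatorname{rpk}$ (right peak number), $\operatorname{epk}$ (exterior peak number), $\operatorname{udr}$ (number of updown runs), and $(\operatorname{udr},\operatorname{pk})$ (the pair consisting of the number of updown runs and the peak number) is shuffle compatible.
   Context: For a finite set $U$ of positive integers, a permutation of $U$ is a linear order $\pi=\pi_1\pi_2\cdots\pi_m$ of all the elements of $U$ (each appearing exactly once); write $\operatorname{dom}(\pi)=U$, $|\pi|=|U|=m$, and let $L(U)$ be the set of permutations of $U$. Two permutations $\pi\in L(U)$, $\pi'\in L(V)$ with $|U|=|V|$ have the same relative order if applying the unique strictly increasing bijection $U\to V$ to the entries of $\pi$ gives $\pi'$. A permutation statistic is a map $\operatorname{St}$ defined on all permutations of all finite sets of positive integers such that $\operatorname{St}(\pi)=\operatorname{St}(\pi')$ whenever $\pi$ and $\pi'$ have the same relative order. For permutations $\pi,\sigma$ with disjoint domains, the shuffle set $\operatorname{Sh}(\pi,\sigma)$ is the set of all $\tau\in L(\operatorname{dom}(\pi)\sqcup\operatorname{dom}(\sigma))$ containing both $\pi$ and $\sigma$ as (not necessarily contiguous) subwords. For a set $\Pi$ of permutations, $\operatorname{St}(\Pi)$ denotes the multiset $\{\{\operatorname{St}(\pi) : \pi\in\Pi\}\}$. A permutation statistic $\operatorname{St}$ is shuffle compatible if for all permutations $\pi,\pi',\sigma,\sigma'$ with $|\pi|=|\pi'|$, $|\sigma|=|\sigma'|$, $\operatorname{dom}(\pi)\cap\operatorname{dom}(\sigma)=\operatorname{dom}(\pi')\cap\operatorname{dom}(\sigma')=\emptyset$,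 $\operatorname{St}(\pi)=\operatorname{St}(\pi')$ and $\operatorname{St}(\sigma)=\operatorname{St}(\sigma')$, one has the equality of multisets $\operatorname{St}(\operatorname{Sh}(\pi,\sigma))=\operatorname{St}(\operatorname{Sh}(\pi',\sigma'))$. For $\pi=\pi_1\cdots\pi_m$, put $\pi_0=0$ and $\pi_{m+1}=0$ (an added $0$ at position $0$ and an added $0$ at position $m+1$). Then: $\operatorname{pk}(\pi)$ is the number of $i$ with $2\le i\le m-1$ and $\pi_{i-1}<\pi_i>\pi_{i+1}$; $\operatorname{lpk}(\pi)$ is the number of peaks of $0\pi$, i.e. of $i$ with $1\le i\le m-1$ and $\pi_{i-1}<\pi_i>\pi_{i+1}$; $\operatorname{rpk}(\pi)$ is the number of peaks of $\pi0$, i.e. of $i$ with $2\le i\le m$ and $\pi_{i-1}<\pi_i>\pi_{i+1}$; $\operatorname{epk}(\pi)$ is the number of peaks of $0\pi0$, i.e. of $i$ with $1\le i\le m$ and $\pi_{i-1}<\pi_i>\pi_{i+1}$. A factor of a sequence is a subsequence of consecutive elements; a monotone factor is a factor that is strictly increasing or strictly decreasing; a birun is a maximal (under containment) monotone factor; an updown run of $\pi$ is a birun of the sequence $0\pi$; and $\operatorname{udr}(\pi)$ is the number of updown runs of $\pi$. For example, $\operatorname{udr}(685934)=5$, the maximal monotone factors of $0685934$ being $068,\ 85,\ 59,\ 93,\ 34$. *)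

(* Defs.v *)
From mathcomp Require Import all_boot.

Set Implicit Arguments.
Unset Strict Implicit.
Unset Printing Implicit Defensive.

(* A permutation of a finite set U of positive integers is the word listing
   the elements of U without repetition; its domain is the set of its letters,
   i.e. the collective predicate [in p]. *)
Definition permutation (p : seq nat) : bool := uniq p && (0 \notin p).

(* A map f that is strictly increasing on dom p and sends p to q letterwise is,
   on dom p, the unique increasing bijection onto dom q. *)
Definition same_relative_order (p q : seq nat) : Prop :=
  exists2 f : nat -> nat, {in p &, {homo f : x y / x < y}} & map f p = q.

Definition permutation_statistic (T : eqType) (St : seq nat -> T) : Prop :=
  forall p q : seq nat, permutation p -> permutation q ->
    same_relative_order p q -> St p = St q.

(* For disjoint permutations p and q, [permutations (p ++ q)] is the
   duplicate-free list of all linear orders of the union of their domains. *)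
Definition Sh (p q : seq nat) : seq (seq nat) :=
  [seq t <- permutations (p ++ q) | subseq p t & subseq q t].

(* Multisets of values are represented by lists up to [perm_eq]. *)
Definition shuffle_compatible (T : eqType) (St : seq nat -> T) : Prop :=
  permutation_statistic St /\
  forall p p' q q' : seq nat,
    permutation p -> permutation p' -> permutation q -> permutation q' ->
    size p = size p' -> size q = size q' ->
    ~~ has [in p] q -> ~~ has [in p'] q' ->
    St p = St p' -> St q = St q' ->
    perm_eq [seq St t | t <- Sh p q] [seq St t | t <- Sh p' q'].

(* The entries of w are numbered from 0, so the interior ones have an index i
   with 1 <= i <= size w - 2. *)
Definition pk (w : seq nat) : nat :=
  \sum_(1 <= i < (size w).-1)
     ((nth 0 w i.-1 < nth 0 w i) && (nth 0 w i.+1 < nth 0 w i)).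

Definition lpk (p : seq nat) : nat := pk (0 :: p).
Definition rpk (p : seq nat) : nat := pk (rcons p 0).
Definition epk (p : seq nat) : nat := pk (0 :: rcons p 0).

(* A nonempty factor of w is given by the pair (i, j) of the positions of its
   first and last letters, with i <= j < size w. *)
Definition factors (w : seq nat) : seq (nat * nat) :=
  [seq (i, j) | i <- iota 0 (size w), j <- iota i (size w - i)].

Definition factor_word (w : seq nat) (a : nat * nat) : seq nat :=
  drop a.1 (take a.2.+1 w).

Definition monotone_factor (w : seq nat) (a : nat * nat) : bool :=
  sorted ltn (factor_word w a) || sorted gtn (factor_word w a).

Definition factor_contained (a b : nat * nat) : bool :=
  (b.1 <= a.1) && (a.2 <= b.2).

Definition birun (w : seq nat) (a : nat * nat) : bool :=
  monotone_factor w a &&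
  all (fun b => monotone_factor w b && factor_contained a b ==> (b == a))
      (factors w).

Definition udr (p : seq nat) : nat := count (birun (0 :: p)) (factors (0 :: p)).

Definition udr_pk (p : seq nat) : nat * nat := (udr p, pk p).

Example udr_685934 : udr [:: 6; 8; 5; 9; 3; 4] = 5.
Proof. by vm_compute. Qed.

(* Main.v *)
Require Import Defs.
From mathcomp Require Import all_boot.
From mathcomp Require Import zify.

Set Implicit Arguments.
Unset Strict Implicit.
Unset Printing Implicit Defensive.

(** Each of the five statistics is governed by the least number of factors in a
    decomposition of the word into alternately increasing and decreasing
    (possibly empty) factors, and the number of such decompositions is
    multiplicative on shuffles.

    Give every letter of a word w a layer in [c, N), weakly increasing along
    w, such that within an odd layer the letters increase and within an even
    layer they decrease; equivalently the sequence of pairs (layer, letter) is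
    sorted for a total order [layer_le].  For words p and q with disjoint
    letters, a layered p and a layered q merge into exactly one sorted
    sequence, which is a layered shuffle, and each layered shuffle arises
    once.  Hence the number of layerings of p times that of q is the sum of
    the numbers of layerings over the shuffles ([sum_layerings_Sh]).  This is
    the argument of Stanley's and Stembridge's (enriched) P-partitions.

    Moving from one letter to the next acts on the counting function by one of
    two linear operators, [transfer false] when the direction (ascent or
    descent) persists and [transfer true] when it changes.  These commute, so
    the number of layerings with n layers depends only on the length of w and
    on the number d of changes of direction, the first layer's direction
    being counted as the initial one; and it is positive exactly when d < n
    ([alternating_count_gt0]).  This triangularity means that the numbers of
    layerings of all shuffles, summed, determine the multiset of the values of
    d ([perm_eq_of_triangular_sums]).

    With the initial direction upwards, d + 1 is udr.  With an odd (even)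
    number of layers the count for d = 2l - 1 and d = 2l (for d = 2e - 2 and
    d = 2e - 1) is the same ([alternating_count_parity]), which makes lpk (epk)
    behave in the same way.  The statistic rpk is lpk of the reversed word.
    Finally pk is half the number d' of changes when the initial direction is
    downwards.  The multisets of d and of d' are each determined, and as d and
    d' differ by one from length 2 on, these two marginals determine the multiset of the
    pairs ([perm_eq_adjacent]), hence that of (udr, pk). *)

(** * Directions of the steps of a word *)

Definition steps (w : seq nat) : seq bool :=
  if w is a :: w' then pairmap ltn a w' else [::].

Definition alternations (e : bool) (w : seq nat) : nat :=
  count id (pairmap addb e (steps w)).

(** * Layerings and their multiplicativity on shuffles *)

(** The pairs are (layer, letter). *)
Definition layer_le (x y : nat * nat) : bool :=
  (x.1 < y.1) || (x.1 == y.1) && (if odd x.1 then x.2 <= y.2 else y.2 <= x.2).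

Lemma layer_le_total : total layer_le.
Proof. by move=> [i a] [j b]; rewrite /layer_le /=; case: ltngtP => //= ->; case: ifP; lia. Qed.

Lemma layer_le_trans : transitive layer_le.
Proof.
move=> [j b] [i a] [k c]; rewrite /layer_le /=.
case: (ltngtP i j) => //= [ltij _|->].
  by case: (ltngtP j k) => //= [/(ltn_trans ltij)-> //|<-]; rewrite ltij.
by case: (ltngtP j k) => //= _; case: ifP; lia.
Qed.

Lemma layer_le_anti : antisymmetric layer_le.
Proof.
move=> [i a] [j b]; rewrite /layer_le /=; case: ltngtP => //= ->.
by case: ifP => _ ?; congr (_, _); lia.
Qed.

(** After the letter a in layer i, a letter b may lie in any layer from i on if
    i has the direction of the step from a to b, and otherwise only from i + 1
    on. *)
Lemma layer_leE i j a b : a != b ->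
  layer_le (i, a) (j, b) = (i + (odd i (+) (a < b)) <= j).
Proof.
rewrite /layer_le /= => neq_ab.
by case: (ltngtP i j) => /= [||<-]; case: (odd i) => /=; case: ltngtP neq_ab => //=; lia.
Qed.

Lemma path_layer_le_min x z :
  path layer_le x z -> all (fun y => x.1 <= y.1) z.
Proof.
move/(order_path_min layer_le_trans); apply: sub_all => y.
by rewrite /layer_le; lia.
Qed.

(** The recursion passes on a bound that has the direction of the next step,
    so that counting will only see the distance of a layer from that bound.
    At the last letter [head b w'] is b, and the bound is then discarded. *)
Fixpoint layerings (N c : nat) (w : seq nat) : seq (seq (nat * nat)) :=
  if w is b :: w' then
    [seq (j, b) :: z | j <- iota c (N - c),
                       z <- layerings N (j + (odd j (+) (b < head b w'))) w']
  else [:: [::]].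

Lemma mem_layerings N c w z : uniq w ->
  (z \in layerings N c w) =
  [&& unzip2 z == w, all (fun x => c <= x.1 < N) z & sorted layer_le z].
Proof.
elim: w c z => [|b w IHw] c z /=; first by case: z => [|x z].
case/andP=> b_w uniq_w; apply/allpairsPdep/idP => [[j [z' []]]|].
  rewrite mem_iota IHw // => j_bd /and3P[/eqP def_w z'_bd z'_s] ->.
  rewrite /= def_w eqxx /=; case: z' def_w z'_bd z'_s => [|[k b'] z'] /= def_w.
    by move=> *; rewrite !andbT; lia.
  have neq_b: b != b' by apply: contraNneq b_w => ->; rewrite -def_w mem_head.
  rewrite -def_w /= => /andP[k_bd z'_bd] z'_s.
  rewrite layer_leE // z'_s (andP k_bd).1 !andbT.
  move: (_ (+) _) k_bd z'_bd => e k_bd z'_bd.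
  have ->: all (fun x => c <= x.1 < N) z'.
    by apply: sub_all z'_bd => x /=; lia.
  by lia.
case: z => [|[j b0] z] //= /and3P[/eqP[-> def_w] /andP[j_bd z_bd] z_s].
exists j, z; split=> //; first by rewrite mem_iota; lia.
rewrite IHw // def_w eqxx /=; case: z def_w z_bd z_s => [|[k b'] z] //= def_w.
move=> /andP[k_bd z_bd] /andP[].
have neq_b: b != b' by apply: contraNneq b_w => ->; rewrite -def_w mem_head.
rewrite -def_w /= layer_leE // => le_k z_s; rewrite z_s le_k (andP k_bd).2 andbT /=.
have /allP zmin := path_layer_le_min z_s.
apply/allP => x xz; have /= := zmin x xz; have /= := allP z_bd x xz; lia.
Qed.

Lemma uniq_layerings N c w : uniq (layerings N c w).
Proof.
elim: w c => //= b w IHw c; apply: allpairs_uniq_dep => [|j _|]; rewrite ?iota_uniq //.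
by move=> [j z] [j' z'] _ _ /= [-> ->].
Qed.

Lemma mem_Sh p q t : uniq (p ++ q) ->
  (t \in Sh p q) =
  [&& perm_eq t (p ++ q), filter [in p] t == p & filter [in q] t == q].
Proof.
move=> uniq_pq; rewrite mem_filter mem_permutations andbC perm_sym.
case: (boolP (perm_eq _ t)) => //= pq_t.
have uniq_t: uniq t by rewrite -(perm_uniq pq_t).
by congr (_ && _); rewrite eq_sym; apply/(subseq_uniqP uniq_t)/eqP.
Qed.

(** Sorting x ++ y merges a layering x of p and a layering y of q into a
    layering of one shuffle of p and q; as the letters are disjoint, x and y
    are recovered by filtering.  Conversely, both filters of a sorted sequence
    are sorted, and merging them gives the sequence back. *)
Lemma sum_layerings_Sh N c p q : uniq (p ++ q) ->
  \sum_(t <- Sh p q) size (layerings N c t) =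
  size (layerings N c p) * size (layerings N c q).
Proof.
move=> uniq_pq.
have /and3P[uniq_p disj_pq uniq_q]: [&& uniq p, ~~ has [in p] q & uniq q].
  by rewrite -cat_uniq.
pose onto (r : seq nat) := filter (fun x : nat * nat => x.2 \in r).
have unzip_onto r z : unzip2 (onto r z) = filter [in r] (unzip2 z).
  by rewrite filter_map.
have ontoK x y : unzip2 x = p -> unzip2 y = q ->
    onto p (x ++ y) = x /\ onto q (x ++ y) = y.
  move=> def_p def_q; split; rewrite /onto filter_cat.
  - rewrite (all_filterP _); last first.
      by apply/allP => u ux; rewrite -def_p map_f.
    rewrite -[RHS]cats0; congr (_ ++ _); apply/eqP; rewrite -(negbK (_ == _)) -has_filter.
    apply: contra disj_pq => /hasP[u uy up]; apply/hasP; exists u.2 => //.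
    by rewrite -def_q map_f.
  rewrite [X in _ ++ X](all_filterP _); last first.
    by apply/allP => u uy; rewrite -def_q map_f.
  rewrite -[RHS]cat0s; congr (_ ++ _); apply/eqP; rewrite -(negbK (_ == _)) -has_filter.
  apply: contra disj_pq => /hasP[u ux uq]; apply/hasP; exists u.2 => //.
  by rewrite /= -def_p map_f.
pose merge2 x y := sort layer_le (x ++ y).
have onto_merge x y : x \in layerings N c p -> y \in layerings N c q ->
    onto p (merge2 x y) = x /\ onto q (merge2 x y) = y.
  rewrite !mem_layerings // => /and3P[/eqP xp _ xs] /and3P[/eqP yq _ ys].
  have [xK yK] := ontoK _ _ xp yq.
  rewrite /onto /merge2 !(filter_sort layer_le_total layer_le_trans).
  by rewrite -!/(onto _ _) xK yK !(sorted_sort layer_le_trans).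
have: perm_eq [seq merge2 x y | x <- layerings N c p, y <- layerings N c q]
              [seq z | t <- Sh p q, z <- layerings N c t].
  apply: uniq_perm.
  - apply: allpairs_uniq; rewrite ?uniq_layerings // => -[x y] [x' y'] /=.
    move=> /allpairsP[[x1 y1] /= [x1p y1q [-> ->]]].
    move=> /allpairsP[[x2 y2] /= [x2p y2q [-> ->]]] eq_merge.
    have [x1K y1K] := onto_merge _ _ x1p y1q.
    have [x2K y2K] := onto_merge _ _ x2p y2q.
    by congr (_, _); [rewrite -x1K eq_merge | rewrite -y1K eq_merge].
  - apply: allpairs_uniq_dep => [|t _|]; rewrite ?uniq_layerings //.
      exact: filter_uniq (permutations_uniq _).
    move=> [t z] [t' z'] /allpairsPdep[t1 [z1 [t1S z1t1 ->]]].
    move=> /allpairsPdep[t2 [z2 [t2S z2t2 ->]]] /= eq_z.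
    have uniqS r : r \in Sh p q -> uniq r.
      by rewrite mem_Sh // => /and3P[/perm_uniq-> _ _].
    move: z1t1 z2t2; rewrite !mem_layerings ?uniqS //.
    by move=> /andP[/eqP<- _] /andP[/eqP<- _]; rewrite eq_z.
  move=> z; apply/allpairsP/allpairsPdep => [[[x y] /= [xp yq ->]]|].
    have [ontop ontoq] := onto_merge _ _ xp yq.
    move: xp yq; rewrite !mem_layerings // => /and3P[/eqP xp xb _] /and3P[/eqP yq yb _].
    have perm_m: perm_eq (unzip2 (merge2 x y)) (p ++ q).
      by rewrite -xp -yq -map_cat perm_map // perm_sort.
    exists (unzip2 (merge2 x y)), (merge2 x y); split=> //.
      by rewrite mem_Sh // perm_m -!unzip_onto ontop ontoq xp yq !eqxx.
    rewrite mem_layerings; last by rewrite (perm_uniq perm_m).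
    by rewrite eqxx all_sort all_cat xb yb sort_sorted //; apply: layer_le_total.
  case=> t [{}z [tS z_t ->]]; move: tS; rewrite mem_Sh //.
  case/and3P=> perm_t /eqP tp /eqP tq; move: z_t.
  rewrite mem_layerings ?(perm_uniq perm_t) // => /and3P[/eqP z_t zb zs].
  exists (onto p z, onto q z); split=> /=.
  - rewrite mem_layerings // unzip_onto z_t tp eqxx sorted_filter ?andbT //=.
      by rewrite all_filter; apply: sub_all zb => x /= ->; rewrite implybT.
    exact: layer_le_trans.
  - rewrite mem_layerings // unzip_onto z_t tq eqxx sorted_filter ?andbT //=.
      by rewrite all_filter; apply: sub_all zb => x /= ->; rewrite implybT.
    exact: layer_le_trans.
  apply: (sorted_eq layer_le_trans layer_le_anti) => //.
    by apply: sort_sorted layer_le_total _.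
  rewrite perm_sym perm_sort.
  have ->: onto q z = filter (predC (fun x : nat * nat => x.2 \in p)) z.
    apply: eq_in_filter => x xz /=.
    have: x.2 \in p ++ q by rewrite -(perm_mem perm_t) -z_t map_f.
    rewrite mem_cat; case: (boolP (x.2 \in q)) => [xq|]; last by rewrite orbF => _ ->.
    by move=> _; apply/esym; apply: contra disj_pq => xp; apply/hasP; exists x.2.
  by rewrite perm_filterC.
move/perm_size; rewrite size_allpairs size_allpairs_dep => ->.
by rewrite sumnE big_map.
Qed.

(** * Counting layerings *)

(** If phi n counts the layerings of the rest of the word with n layers left at
    the next step, then this counts those with n layers left now: k is the
    number of layers skipped before placing the letter, and f says whether the
    direction changes.  As power series in x, the operators are multiplication
    by (1 + x^2) / (1 - x^2) for f = false and by 2x / (1 - x^2) for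
    f = true. *)
Definition transfer (f : bool) (phi : nat -> nat) (n : nat) : nat :=
  \sum_(k < n) phi (n - (k + (odd k (+) f))).

Lemma eq_transfer f phi psi : phi =1 psi -> transfer f phi =1 transfer f psi.
Proof. by move=> eq_phi n; apply: eq_bigr. Qed.

Fixpoint transfers (s : seq bool) : nat -> nat :=
  if s is f :: s' then transfer f (transfers s') else id.

(** The bound c has the direction odd c, which is thus the initial direction
    that the first step of the word is compared with. *)
Lemma size_layerings N c b w :
  size (layerings N c (b :: w)) =
  transfers (pairmap addb (odd c) (steps (b :: w))) (N - c).
Proof.
have size_cons a d v : size (layerings N d (a :: v)) =
    \sum_(k < N - d) size (layerings N (d + k + (odd (d + k) (+) (a < head a v))) v).
  rewrite [LHS]size_allpairs_dep sumnE big_map -{1}[d]addn0 iotaDl big_map.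
  by rewrite -[X in iota 0 X]subn0 big_mkord.
elim: w b c => [|b' w IHw] b c; rewrite size_cons.
  by rewrite /= big_const_ord iter_addn_0 mul1n.
apply: eq_bigr => k _; rewrite IHw /= !oddD !oddb.
have ->: odd c (+) odd k (+) (odd c (+) odd k (+) (b < b')) = (b < b').
  by case: (odd c) (odd k) (b < b') => [] [] [].
rewrite -!subnDA !addnA; congr (transfers _ (N - (_ + nat_of_bool _))).
by case: (odd c) (odd k) (b < b') => [] [] [].
Qed.

Lemma transfer0 f phi : transfer f phi 0 = 0.
Proof. exact: big_ord0. Qed.

Lemma transfer1 f phi : phi 0 = 0 -> transfer f phi 1 = if f then 0 else phi 1.
Proof. by rewrite /transfer big_ord1; case: f. Qed.

(** The factor 1 / (1 - x^2), shared by both operators, as a recurrence. *)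
Lemma transferSS f phi n :
  transfer f phi n.+2 = phi (n.+2 - f) + phi (n + f) + transfer f phi n.
Proof.
rewrite /transfer !big_ord_recl /= addnA; congr (_ + _ + _).
  by rewrite /bump; congr phi; case: f => /=; lia.
by apply: eq_bigr => k _; rewrite /bump /= negbK; congr phi; lia.
Qed.

Lemma nat_ind_step2 (P : nat -> Prop) :
  P 0 -> P 1 -> (forall n, P n -> P n.+2) -> forall n, P n.
Proof.
move=> P0 P1 PS n; suff: P n /\ P n.+1 by case.
by elim: n => // n [Pn Pn1]; split=> //; apply: PS.
Qed.

Lemma transferC phi : phi 0 = 0 ->
  transfer true (transfer false phi) =1 transfer false (transfer true phi).
Proof.
move=> phi0.
(* Both sides are the coefficient of x^(n + 2) in
   2x * (1 + x^2) / (1 - x^2) * phi *)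
have double n : 2 * transfer false phi n.+1 = transfer true phi n.+2 + transfer true phi n.
  elim/nat_ind_step2: n => [||n IHn].
  - by rewrite (transferSS true) !transfer0 !transfer1 //= !addn0 mul2n addnn.
  - rewrite !(transferSS _ phi) !transfer0 !transfer1 //= !addn0 phi0 addn0.
    by rewrite subn0 subn1 mulSn mul1n.
  rewrite (transferSS false) (transferSS true) mulnDr IHn.
  rewrite [transfer true phi n.+2]transferSS /= !subn0 !addn0 !addn1 !subn1 /=.
  by lia.
elim/nat_ind_step2 => [||n IHn].
- by rewrite !transfer0.
- by rewrite !transfer1 // ?transfer0.
rewrite !(transferSS _ (transfer _ _)) IHn /= subn0 subn1 addn0 addn1 /=.
by have := double n; lia.
Qed.

(** The number of layerings with n layers of a word of length m + 1 with d
    changes of direction. *)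
Definition alternating_count (m d : nat) : nat -> nat :=
  iter d (transfer true) (iter (m - d) (transfer false) id).

Lemma iter_transfer0 f n phi : phi 0 = 0 -> iter n (transfer f) phi 0 = 0.
Proof. by case: n => //= n _; apply: transfer0. Qed.

(** As the operators commute, only the number of changes matters and not their
    positions. *)
Lemma transfersE s : transfers s =1 alternating_count (size s) (count id s).
Proof.
rewrite /alternating_count.
elim: s => // -[] s IHs /=; rewrite ?add1n ?add0n ?subSS; first by apply: eq_transfer.
rewrite subSn; last exact: count_size.
move=> n; rewrite (eq_transfer _ IHs); move: (size s - _) => k.
elim: (count id s) n => //= d IHd n.
rewrite -transferC; first by apply: eq_transfer IHd _.
by do 2!rewrite iter_transfer0 //.
Qed.

(** The least number of layers that suffices grows by one at a change of
    direction and stays the same otherwise. *)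
Lemma transfer_gt0 f phi d : (forall n, (0 < phi n) = (d < n)) ->
  forall n, (0 < transfer f phi n) = (d + f < n).
Proof.
move=> phi_gt0 n.
have ->: (0 < transfer f phi n) = [exists k : 'I_n, 0 < phi (n - (k + (odd k (+) f)))].
  rewrite lt0n /transfer sum_nat_eq0 negb_forall.
  by apply: eq_existsb => k; rewrite lt0n.
apply/existsP/idP => [[k]|]; rewrite ?phi_gt0.
  case: k => -[|k] /= ltkn; first by rewrite add0n; lia.
  by case: f => /=; lia.
case: n => // n ltdn; exists ord0; rewrite phi_gt0 /=; lia.
Qed.

Lemma alternating_count_gt0 m d n : (0 < alternating_count m d n) = (d < n).
Proof.
have iter_gt0 phi c f k : (forall n, (0 < phi n) = (c < n)) ->
    forall n, (0 < iter k (transfer f) phi n) = (c + f * k < n).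
  move=> phi_gt0; elim: k => [|k IHk] {}n /=; first by rewrite muln0 addn0.
  by rewrite (transfer_gt0 f IHk); congr (_ < _); lia.
rewrite (iter_gt0 _ 0) ?mul1n // => {}n; rewrite (iter_gt0 _ 0) //.
Qed.

(** The two series above are even for f = false and odd for f = true, so that
    values of phi at even and at odd arguments do not mix. *)
Lemma eq_transfer_parity f e phi psi :
  (forall n, odd n = e -> phi n = psi n) ->
  forall n, odd n = e (+) f -> transfer f phi n = transfer f psi n.
Proof.
move=> eq_phi n odd_n; apply: eq_bigr => k _; apply: eq_phi.
have ltkn := ltn_ord k; rewrite oddB; last by case: (odd k (+) f) => /=; lia.
by rewrite odd_n oddD oddb addKb -addbA addbb addbF.
Qed.

Lemma transfer_id_even n : ~~ odd n -> transfer true id n = transfer false id n.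
Proof.
elim/nat_ind_step2: n => [_|//|n IHn /=]; first by rewrite !transfer0.
by rewrite negbK => n_even; rewrite !transferSS /= IHn //; lia.
Qed.

(** On the counting function n of a single letter, both operators agree at
    even arguments ([transfer_id_even]); the other operators carry this
    agreement to the arguments with the parity of d. *)
Lemma alternating_count_parity m d n : d < m -> odd n = odd d ->
  alternating_count m d.+1 n = alternating_count m d n.
Proof.
move=> lt_dm; rewrite /alternating_count iterSr.
have ->: m - d = (m - d.+1).+1 by lia.
have step: forall n, odd n = false ->
    transfer true (iter (m - d.+1) (transfer false) id) n =
    iter (m - d.+1).+1 (transfer false) id n.
  move: (m - d.+1) => k {}n n_even.
  transitivity (iter k (transfer false) (transfer true id) n).
    elim: k n {n_even} => //= k IHk n; rewrite transferC; last by rewrite iter_transfer0.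
    exact: eq_transfer.
  rewrite iterSr; elim: k n n_even => [|k IHk] n n_even /=.
    by rewrite transfer_id_even ?n_even.
  by apply: (eq_transfer_parity (e := false)) IHk _ _; rewrite n_even.
move: (transfer true _) (iter _.+1 _ _) step => phi psi step.
elim: d n {lt_dm} => [|d IHd] n /=; first exact: step.
by rewrite -addbT; apply: eq_transfer_parity.
Qed.

(** * The statistics in terms of changes of direction *)

Definition neq_sorted (w : seq nat) : bool := sorted (fun a b => a != b) w.

Lemma pk_cons3 a b c w :
  pk (a :: b :: c :: w) = ((a < b) && (c < b)) + pk (b :: c :: w).
Proof.
rewrite /pk /= big_ltn // big_add1; congr (_ + _).
by apply: eq_big_nat => -[|i].
Qed.

(** Among the changes of direction from an initial descent, every second one
    leads from an ascent to a descent. *)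
Lemma pkE w : neq_sorted w -> pk w = (alternations false w)./2.
Proof.
case: w => [|a [|b w]]; try by rewrite /pk big_geq.
elim: w a b => [|c w IHw] a b.
  by rewrite /pk big_geq //= /alternations /=; case: (a < b).
case/andP=> neq_ab neq_w; rewrite pk_cons3 IHw // /alternations /=.
case/andP: neq_w => neq_bc _.
have -> : (c < b) = ~~ (b < c) by lia.
by case: (a < b); case: (b < c) => /=; rewrite ?add0n ?add1n ?addn0.
Qed.

Lemma uniq_neq_sorted w : uniq w -> neq_sorted w.
Proof.
rewrite uniq_pairwise; exact: pairwise_sorted.
Qed.

Lemma neq_sorted_cons0 p : permutation p -> neq_sorted (0 :: p).
Proof.
case/andP=> p_uniq p0; apply: uniq_neq_sorted.
by rewrite /= p0.
Qed.

(** The prefixed 0 makes the first step an ascent, which is itself one change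
    from an initial descent. *)
Lemma lpkE p : permutation p -> lpk p = uphalf (alternations true p).
Proof.
move=> perm_p; rewrite /lpk pkE ?neq_sorted_cons0 //.
case: p perm_p => [|b w] //; rewrite /permutation inE negb_or.
case/and3P=> _ neq_b0 _; have b_gt0 : 0 < b by lia.
by rewrite /alternations /= b_gt0.
Qed.

(** Ending with a descent forces the parity of the number of changes. *)
Lemma count_addb_rcons e s :
  count id (pairmap addb e (rcons s false)) =
  (count id (pairmap addb e s) + e).+1./2.*2 - e.
Proof.
elim: s e => [|f s IHs] e /=; first by case: e.
rewrite IHs; move: (count _ _) => n; case: e f => [] [] /=; lia.
Qed.

Lemma epkE p : permutation p -> p != [::] -> epk p = (alternations true p)./2.+1.
Proof.
move=> perm_p p_neq0; rewrite /epk pkE; last first.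
  have := neq_sorted_cons0 perm_p; rewrite /neq_sorted /= rcons_path => ->.
  case: p perm_p p_neq0 => //= b w /andP[_ w0] _; apply: contraNneq w0 => <-.
  exact: mem_last.
case: p perm_p p_neq0 => //= b w /andP[_]; rewrite inE negb_or => /andP[neq_b0 _] _.
have b_gt0 : 0 < b by lia.
rewrite /alternations /= b_gt0.
have -> : pairmap ltn b (rcons w 0) = rcons (pairmap ltn b w) false.
  by elim: w b {neq_b0 b_gt0} => //= c w IHw b; rewrite IHw.
by rewrite count_addb_rcons; move: (count _ _) => n; lia.
Qed.

Lemma pk_rev w : pk (rev w) = pk w.
Proof.
rewrite /pk size_rev big_nat_rev; apply: eq_big_nat => i i_bd.
rewrite !nth_rev; try lia.
rewrite andbC.
congr (nat_of_bool ((nth _ _ _ < nth _ _ _) && (nth _ _ _ < nth _ _ _))); lia.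
Qed.

Lemma rpkE p : rpk p = lpk (rev p).
Proof. by rewrite /lpk -rev_rcons pk_rev. Qed.

Lemma steps_map f p : {in p &, {homo f : x y / x < y}} ->
  steps (map f p) = steps p.
Proof.
case: p => //= a w; elim: w a => //= b w IHw a mono_f.
have ltE : (f a < f b) = (a < b).
  case: (ltngtP a b) => [|ltba|->]; last by rewrite ltnn.
    by apply: mono_f; rewrite !inE eqxx ?orbT.
  apply/negbTE; rewrite -leqNgt ltnW //.
  by apply: mono_f; rewrite ?inE ?eqxx ?orbT.
by rewrite ltE IHw // => x y xw yw; apply: mono_f; rewrite inE ?xw ?yw orbT.
Qed.

Section Biruns.

Variable w : seq nat.
Hypothesis neq_w : neq_sorted w.
Hypothesis size_w : 1 < size w.

Let up i := nth 0 w i < nth 0 w i.+1.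

Lemma up_lt i : i.+1 < size w -> (nth 0 w i.+1 < nth 0 w i) = ~~ up i.
Proof. by move=> lti; have /(sortedP 0)/(_ i lti) := neq_w; rewrite /up; lia. Qed.

Lemma monotone_factorP i j : i <= j < size w ->
  reflect (forall k, i <= k < j -> up k = up i) (monotone_factor w (i, j)).
Proof.
case/andP=> le_ij ltj; rewrite /monotone_factor /factor_word /=.
have nth_f k : k <= j - i -> nth 0 (drop i (take j.+1 w)) k = nth 0 w (i + k).
  by move=> le_k; rewrite nth_drop nth_take //; lia.
have size_f : size (drop i (take j.+1 w)) = (j - i).+1.
  by rewrite size_drop size_takel //; lia.
apply: (iffP orP) => [[/(sortedP 0)|/(sortedP 0)] mono k k_bd | up_const].
- have up_true l : i <= l < j -> up l.
    move=> l_bd; have := mono (l - i); rewrite size_f !nth_f; try lia.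
    by rewrite addnS subnKC; [apply; lia | lia].
  by rewrite !up_true //; lia.
- have up_false l : i <= l < j -> up l = false.
    move=> l_bd; have := mono (l - i); rewrite size_f !nth_f; try lia.
    rewrite addnS subnKC /=; last by lia.
    by move=> lt_l; apply/negbTE; rewrite -leqNgt ltnW // lt_l //; lia.
  by rewrite !up_false //; lia.
case up_i: (up i); [left | right]; apply/(sortedP 0) => k; rewrite size_f => ltk.
  by rewrite !nth_f ?addnS; try lia; apply: etrans (up_const (i + k) _) _; lia.
by rewrite !nth_f ?addnS /= ?up_lt ?up_const ?up_i; lia.
Qed.

Lemma mem_factors b : (b \in factors w) = (b.1 <= b.2 < size w).
Proof.
apply/allpairsPdep/idP => [[i [j [+ + ->]]]|].
  by rewrite !mem_iota /=; lia.
case: b => i j /= ij; exists i, j; split=> //; rewrite mem_iota; lia.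
Qed.

Let start i := (i.+1 < size w) && ((i == 0) || (up i.-1 != up i)).
Let stop i j := (j.+1 == size w) || (up j != up i).

(** A factor is a birun when it has a step and can be extended neither to the
    left ([start]) nor to the right ([stop]). *)
Lemma birunE i j : i <= j < size w ->
  birun w (i, j) =
  [&& i < j, start i, stop i j & monotone_factor w (i, j)].
Proof.
move=> ij; rewrite /birun andbC; case: (boolP (monotone_factor w (i, j))).
  2: by rewrite !andbF.
move=> mono_ij; rewrite !andbT.
have up_ij := monotone_factorP ij mono_ij.
apply/allP/and3P => [maxi | [lt_ij /andP[_ start_i] stop_j] [b1 b2]]; last first.
  rewrite mem_factors /factor_contained /= => b12.
  apply/implyP => /and3P[/(monotone_factorP b12) up_b le_b1 le_b2].
  have -> : b1 = i.
    apply: contraTeq start_i => neq_b1; rewrite negb_or negbK.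
    apply/andP; split; first by lia.
    by rewrite (up_b i.-1) ?(up_b i) //; lia.
  have -> // : b2 = j.
  apply: contraTeq stop_j => neq_b2; rewrite negb_or negbK.
  apply/andP; split; first by lia.
  by rewrite (up_b j) ?(up_b i) //; lia.
have {}maxi b1 b2 : b1 <= i -> j <= b2 -> b2 < size w ->
    (forall k, b1 <= k < b2 -> up k = up b1) -> (b1 == i) && (b2 == j).
  move=> le_b1 le_b2 lt_b2 up_b.
  have b12: b1 <= b2 < size w by lia.
  have := maxi (b1, b2); rewrite mem_factors /= b12 => /(_ isT).
  rewrite /factor_contained /= le_b1 le_b2 !andbT => /implyP; apply.
  exact/(monotone_factorP b12).
have lt_ij : i < j.
  rewrite ltn_neqAle (andP ij).1 andbT; apply/eqP => eq_ij.
  case: (ltnP i.+1 (size w)) => i_bd.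
    suff: (i == i) && (i.+1 == j) by lia.
    by apply: maxi => [|||k k_bd]; try lia; congr up; lia.
  suff: (i.-1 == i) && (i == j) by lia.
  by apply: maxi => [|||k k_bd]; try lia; congr up; lia.
split=> //.
  rewrite /start; apply/andP; split; first by lia.
  apply/norP => -[i_neq0 /negPn/eqP up_i].
  suff: (i.-1 == i) && (j == j) by lia.
  apply: maxi => [|||k k_bd]; try lia.
  case: (ltnP k i) => le_ki; first by congr up; lia.
  by rewrite up_ij ?up_i //; lia.
apply/norP => -[j_neq /negPn/eqP up_j].
suff: (i == i) && (j.+1 == j) by lia.
apply: maxi => [|||k k_bd]; try lia.
case: (ltnP k j) => le_kj; first by rewrite up_ij //; lia.
by rewrite -up_j; congr up; lia.
Qed.

(** The birun that starts at i ends at the first later position where the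
    direction changes. *)
Lemma count_birun_from i : i < size w ->
  count (fun j => birun w (i, j)) (iota i (size w - i)) = start i.
Proof.
move=> lt_i; case: (boolP (start i)) => [start_i | not_start]; last first.
  rewrite (@eq_in_count _ _ pred0) ?count_pred0 // => j; rewrite mem_iota => j_bd.
  by rewrite birunE ?(negPf not_start) ?andbF //; lia.
have [lt_i1 _] := andP start_i.
have ex_stop : exists j, (i < j) && stop i j.
  by exists (size w).-1; rewrite /stop; apply/andP; split; lia.
case: (ex_minnP ex_stop) => m /andP[lt_im stop_m] min_m.
have lt_m : m < size w.
  have := min_m (size w).-1; rewrite /stop prednK ?eqxx //; lia.
rewrite (@eq_in_count _ _ (pred1 m)) => [|j].
  by rewrite count_uniq_mem ?iota_uniq // mem_iota; lia.
rewrite mem_iota => j_bd; have ij: i <= j < size w by lia.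
rewrite birunE // start_i /=.
apply/and3P/eqP => [[lt_ij stop_j /(monotone_factorP ij) up_ij] | ->{j j_bd ij}].
  have le_mj: m <= j by apply: min_m; rewrite lt_ij.
  apply/eqP; rewrite eqn_leq le_mj andbT leqNgt; apply/negP => lt_mj.
  by move: stop_m; rewrite /stop (up_ij m) ?eqxx //; lia.
split=> //; apply/monotone_factorP => [|k k_bd]; first by lia.
case: (ltngtP k i) => [||->] // ltik; first by lia.
case: (up k =P up i) => // /eqP up_k.
by have := min_m k; rewrite ltik /stop up_k orbT => /(_ isT); lia.
Qed.

Lemma count_birun :
  count (birun w) (factors w) =
  (count id (pairmap addb (head false (steps w)) (behead (steps w)))).+1.
Proof.
have -> : count (birun w) (factors w) = \sum_(0 <= i < size w) start i.
  rewrite count_flatten -map_comp sumnE big_map /index_iota subn0.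
  rewrite big_seq [RHS]big_seq; apply: eq_bigr => i; rewrite mem_iota => i_bd.
  by rewrite /= count_map -count_birun_from.
have size_steps : size (steps w) = (size w).-1.
  by case: (w) => //= a v; rewrite size_pairmap.
have nth_steps i : i.+1 < size w -> nth false (steps w) i = up i.
  by rewrite /up; case: (w) => //= a v lti; rewrite (nth_pairmap 0).
rewrite /start; case def_n: (size w) size_w size_steps nth_steps => [|[|n]] // _.
case: (steps w) => //= e s [size_s] nth_s.
rewrite big_ltn // big_add1 /= big_nat_recr //= ltnn addn0 add1n; congr _.+1.
rewrite -sum1_count (big_nth false) size_pairmap size_s [RHS]big_mkcond.
apply: eq_big_nat => i /andP[_ lt_i]; rewrite (nth_pairmap false) ?size_s // !ltnS lt_i.
rewrite -(nth_s i) ?ltnS 1?ltnW // -(nth_s i.+1) //=.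
by case: (nth _ _ _); case: (nth _ _ _).
Qed.

End Biruns.

Lemma udrE p : permutation p -> udr p = (alternations true p).+1.
Proof.
case: p => [|b w] perm_p; first by vm_compute.
rewrite /udr count_birun ?neq_sorted_cons0 //.
case/andP: perm_p; rewrite inE negb_or => _ /andP[neq_b0 _].
have b_gt0 : 0 < b by lia.
by rewrite /alternations /= b_gt0.
Qed.

(** * Shuffle compatibility *)

Lemma sum_count_mem (s : seq nat) (g : nat -> nat) K :
  (forall v, K <= v -> g v = 0) ->
  \sum_(v <- s) g v = \sum_(v < K) count_mem (val v) s * g v.
Proof.
move=> g0; elim: s => [|u s IHs]; first by rewrite big_nil big1.
rewrite big_cons IHs /= [RHS](eq_bigr (fun v : 'I_K =>
  (u == v) * g v + count_mem (val v) s * g v)).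
  rewrite big_split /=; congr (_ + _); case: (ltnP u K) => [ltuK | /g0 gu0].
    rewrite (bigD1 (Ordinal ltuK)) //= eqxx mul1n big1 ?addn0 // => v neq_v.
    by rewrite -val_eqE /= eq_sym in neq_v; rewrite (negPf neq_v).
  by rewrite gu0 big1 // => v _; case: eqP => // <-; rewrite gu0 muln0.
by move=> v _; rewrite mulnDl.
Qed.

(** Once the multiplicities of all u < v agree, the sums for k = v leave only
    the multiplicity of v, with the nonzero factor phi v v. *)
Lemma perm_eq_of_triangular_sums (phi : nat -> nat -> nat) (s s' : seq nat) :
  (forall k v, (0 < phi k v) = (v <= k)) ->
  (forall k, \sum_(v <- s) phi k v = \sum_(v <- s') phi k v) ->
  perm_eq s s'.
Proof.
move=> phi_gt0 eq_sums; rewrite /perm_eq; apply/allP=> v _ /=; apply/eqP.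
elim/ltn_ind: v => v IHv.
have phi0 u : v.+1 <= u -> phi v u = 0 by move=> ltvu; have := phi_gt0 v u; lia.
have := eq_sums v; rewrite !(sum_count_mem _ phi0) !big_ord_recr /=.
rewrite (eq_bigr (fun u : 'I_v => count_mem (val u) s' * phi v u)) => [|u _].
  move/addnI/eqP; rewrite eqn_pmul2r ?phi_gt0 // => /eqP ->; done.
by rewrite IHv.
Qed.

Lemma size_Sh_mem p q t : t \in Sh p q -> size t = size p + size q.
Proof. by rewrite mem_filter mem_permutations => /andP[_ /perm_size]; rewrite size_cat. Qed.

Lemma permutation_Sh p q t : permutation p -> permutation q -> ~~ has [in p] q ->
  t \in Sh p q -> permutation t.
Proof.
move=> /andP[p_uniq p0] /andP[q_uniq q0] disj_pq.
rewrite mem_filter mem_permutations => /andP[_ pq_t].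
rewrite /permutation (perm_uniq pq_t) (perm_mem pq_t) cat_uniq p_uniq q_uniq disj_pq.
by rewrite mem_cat negb_or p0.
Qed.

(** The layer e of the bool e is odd, i.e. increasing, exactly when e is true. *)
Definition layering_number (e : bool) (n : nat) (w : seq nat) : nat :=
  size (layerings (e + n) e w).

Lemma layering_numberE e n w : w != [::] ->
  layering_number e n w =
  alternating_count (size w).-1 (alternations e w) n.
Proof.
case: w => // b w _; rewrite /layering_number size_layerings addKn oddb transfersE.
by rewrite size_pairmap /= size_pairmap.
Qed.

Lemma alternations_lt e w : w != [::] -> alternations e w <= (size w).-1.
Proof.
case: w => //= b w _; rewrite (leq_trans (count_size _ _)) // size_pairmap.
by rewrite /= size_pairmap.
Qed.

(** The common argument for lpk, epk and the number of changes: if the counts of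
    layerings with ns 0, ns 1, ... layers are triangular in St, then St is
    determined on shuffles.  The empty word has one layering whatever the
    number of layers, hence its exclusion. *)
Lemma perm_eq_Sh_layering e (St : seq nat -> nat) (phi : nat -> nat -> nat -> nat)
    (ns : nat -> nat) p p' q q' :
  (forall m k v, (0 < phi m k v) = (v <= k)) ->
  (forall w k, permutation w -> w != [::] ->
     layering_number e (ns k) w = phi (size w) k (St w)) ->
  permutation p -> permutation p' -> permutation q -> permutation q' ->
  size p = size p' -> size q = size q' ->
  ~~ has [in p] q -> ~~ has [in p'] q' ->
  St p = St p' -> St q = St q' ->
  perm_eq [seq St t | t <- Sh p q] [seq St t | t <- Sh p' q'].
Proof.
move=> phi_gt0 phiE perm_p perm_p' perm_q perm_q' size_p size_q disj disj' St_p St_q.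
have eq_layering w w' k : permutation w -> permutation w' -> size w = size w' ->
    St w = St w' -> layering_number e (ns k) w = layering_number e (ns k) w'.
  move=> perm_w perm_w' size_w St_w; case: (eqVneq w [::]) => [w0|w_neq0].
    by move: size_w; rewrite w0 => /esym/size0nil->.
  by rewrite !phiE // -?size_eq0 -?size_w ?size_eq0 // St_w.
case: (eqVneq (p ++ q) [::]) => [/(congr1 size)|pq_neq0].
  rewrite size_cat /= => size0; move: size_p size_q.
  have [-> ->] : p = [::] /\ q = [::] by split; apply: size0nil; lia.
  by move=> /esym/size0nil-> /esym/size0nil->.
have sumE r1 r2 k : permutation r1 -> permutation r2 -> ~~ has [in r1] r2 ->
    size r1 = size p -> size r2 = size q ->
    \sum_(v <- [seq St t | t <- Sh r1 r2]) phi (size p + size q) k v =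
    layering_number e (ns k) r1 * layering_number e (ns k) r2.
  move=> perm_r1 perm_r2 disj_r size_r1 size_r2; rewrite big_map.
  rewrite -sum_layerings_Sh; last first.
    by rewrite cat_uniq (andP perm_r1).1 (andP perm_r2).1 disj_r.
  rewrite big_seq [RHS]big_seq; apply: eq_bigr => t t_Sh.
  have size_t := size_Sh_mem t_Sh.
  rewrite -/(layering_number e (ns k) t) phiE ?size_t ?size_r1 ?size_r2 //.
    exact: permutation_Sh t_Sh.
  by rewrite -size_eq0 size_t size_r1 size_r2 -size_cat size_eq0.
apply: perm_eq_of_triangular_sums (phi_gt0 (size p + size q)) _ => k.
by rewrite !sumE // (eq_layering p p') // (eq_layering q q').
Qed.

(** The steps of a word only depend on the relative order of its letters. *)
Lemma statistic_steps (T : eqType) (St : seq nat -> T) (F : nat -> seq bool -> T) :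
  (forall p, permutation p -> St p = F (size p) (steps p)) ->
  permutation_statistic St.
Proof.
move=> StE p q perm_p perm_q [f mono_f def_q].
by rewrite !StE // -def_q size_map steps_map.
Qed.

Lemma perm_eq_Sh_alternations e p p' q q' :
  permutation p -> permutation p' -> permutation q -> permutation q' ->
  size p = size p' -> size q = size q' ->
  ~~ has [in p] q -> ~~ has [in p'] q' ->
  alternations e p = alternations e p' -> alternations e q = alternations e q' ->
  perm_eq [seq alternations e t | t <- Sh p q] [seq alternations e t | t <- Sh p' q'].
Proof.
apply: (perm_eq_Sh_layering (e := e) (ns := succn)
          (phi := fun m k d => alternating_count m.-1 d k.+1)).
  by move=> m k v; rewrite alternating_count_gt0.
by move=> w k _ w_neq0; rewrite layering_numberE.
Qed.

(** With 2k + 1 layers, the first and the last ones increasing, d changes can be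
    replaced by the least number with the same value uphalf d of lpk. *)
Lemma lpk_shuffle_compatible : shuffle_compatible lpk.
Proof.
split.
  apply: (statistic_steps (F := fun _ s => uphalf (count id (pairmap addb true s)))).
  exact: lpkE.
move=> p p' q q'.
apply: (perm_eq_Sh_layering (e := true) (St := lpk) (ns := fun k => k.*2.+1)
          (phi := fun m k l => alternating_count m.-1 (l.*2).-1 k.*2.+1)).
  by move=> m k v; rewrite alternating_count_gt0; lia.
move=> w k perm_w w_neq0; rewrite layering_numberE // lpkE //.
have := alternations_lt true w_neq0; move: (alternations _ _) => d le_d.
case: (boolP (odd d)) => odd_d; first by congr alternating_count; lia.
case: d le_d odd_d => [|d] //= le_d; rewrite negbK => odd_d.
rewrite alternating_count_parity //; last by rewrite /= odd_double odd_d.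
by congr alternating_count; lia.
Qed.

(** The same as for lpk, with 2k layers, the last one decreasing. *)
Lemma epk_shuffle_compatible : shuffle_compatible epk.
Proof.
split.
  apply: (statistic_steps (F := fun m s =>
    if m is 0 then 0 else (count id (pairmap addb true s))./2.+1)).
  move=> p perm_p; case: (eqVneq p [::]) => [->|p_neq0].
    by rewrite /epk /pk big_geq.
  by rewrite epkE //; case: (p) p_neq0.
move=> p p' q q'.
apply: (perm_eq_Sh_layering (e := true) (St := epk) (ns := fun k => k.*2)
          (phi := fun m k l => if l is l'.+1 then alternating_count m.-1 l'.*2 k.*2 else 1)).
  by move=> m k [|v]; rewrite ?alternating_count_gt0 ?ltn_double.
move=> w k perm_w w_neq0; rewrite layering_numberE // epkE //.
have := alternations_lt true w_neq0; move: (alternations _ _) => d le_d.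
case: (boolP (odd d)) => odd_d; last by congr alternating_count; lia.
case: d le_d odd_d => [|d] //= le_d odd_d.
rewrite alternating_count_parity //; last by rewrite odd_double (negPf odd_d).
by congr alternating_count; lia.
Qed.

Lemma permutation_rev p : permutation (rev p) = permutation p.
Proof. by rewrite /permutation rev_uniq mem_rev. Qed.

Lemma perm_Sh_rev p q : perm_eq [seq rev t | t <- Sh p q] (Sh (rev p) (rev q)).
Proof.
apply: uniq_perm.
- by rewrite (map_inj_uniq (can_inj revK)) (filter_uniq _ (permutations_uniq _)).
- exact: filter_uniq (permutations_uniq _).
move=> t; rewrite -{1}[t]revK (mem_map (can_inj revK)) !mem_filter !mem_permutations.
rewrite -{1}[p]revK -{1}[q]revK !subseq_rev; congr (_ && _).
rewrite perm_rev; have /permPr-> // : perm_eq (p ++ q) (rev p ++ rev q).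
by rewrite -rev_cat perm_sym perm_rev perm_catC.
Qed.

Lemma rpk_shuffle_compatible : shuffle_compatible rpk.
Proof.
have [lpk_stat lpk_compat] := lpk_shuffle_compatible; split.
  move=> p q perm_p perm_q [f mono_f def_q]; rewrite !rpkE.
  apply: lpk_stat; rewrite ?permutation_rev //; exists f; last by rewrite map_rev def_q.
  by move=> x y; rewrite !mem_rev; apply: mono_f.
move=> p p' q q' perm_p perm_p' perm_q perm_q' size_p size_q disj disj'.
rewrite !rpkE => St_p St_q; rewrite !(eq_map rpkE) !(map_comp lpk rev).
apply: perm_trans (perm_map _ (perm_Sh_rev p q)) _.
rewrite perm_sym; apply: perm_trans (perm_map _ (perm_Sh_rev p' q')) _; rewrite perm_sym.
have has_rev r s : has [in rev r] (rev s) = has [in r] s.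
  by rewrite has_rev; apply: eq_has => x; rewrite /= mem_rev.
by apply: lpk_compat; rewrite ?permutation_rev ?size_rev ?has_rev.
Qed.

Lemma udr_shuffle_compatible : shuffle_compatible udr.
Proof.
split.
  by apply: (statistic_steps (F := fun _ s => (count id (pairmap addb true s)).+1)) udrE.
move=> p p' q q' perm_p perm_p' perm_q perm_q' size_p size_q disj disj'.
rewrite !udrE // => -[alt_p] [alt_q].
have mapE r1 r2 : permutation r1 -> permutation r2 -> ~~ has [in r1] r2 ->
    [seq udr t | t <- Sh r1 r2] = map succn [seq alternations true t | t <- Sh r1 r2].
  move=> perm_r1 perm_r2 disj_r; rewrite -map_comp; apply/eq_in_map => t.
  by move/(permutation_Sh perm_r1 perm_r2 disj_r)/udrE.
by rewrite !mapE // perm_map // perm_eq_Sh_alternations.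
Qed.

Definition adjacent (x : nat * nat) : bool := (x.2 == x.1.+1) || (x.1 == x.2.+1).

(** Let A_u and C_u be the multiplicities of (u, u+1) and (u+1, u).  The
    marginals give A_u + C_(u-1) and C_u + A_(u-1), and so all of them by
    induction on u. *)
Lemma perm_eq_adjacent (s s' : seq (nat * nat)) :
  all adjacent s -> all adjacent s' ->
  perm_eq (unzip1 s) (unzip1 s') -> perm_eq (unzip2 s) (unzip2 s') ->
  perm_eq s s'.
Proof.
move=> adj_s adj_s' /permP eq1 /permP eq2.
have count1 r u : all adjacent r ->
    count_mem u (unzip1 r) = count_mem (u, u.+1) r + (0 < u) * count_mem (u, u.-1) r.
  elim: r => [|[a b] r IHr] /=; first by rewrite muln0.
  case/andP=> adj_ab /IHr->; move: adj_ab; rewrite /adjacent /= !xpair_eqE.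
  by case: u {IHr} => [|u] /=; lia.
have count2 r u : all adjacent r ->
    count_mem u (unzip2 r) = count_mem (u.+1, u) r + (0 < u) * count_mem (u.-1, u) r.
  elim: r => [|[a b] r IHr] /=; first by rewrite muln0.
  case/andP=> adj_ab /IHr->; move: adj_ab; rewrite /adjacent /= !xpair_eqE.
  by case: u {IHr} => [|u] /=; lia.
have main u : count_mem (u, u.+1) s = count_mem (u, u.+1) s' /\
              count_mem (u.+1, u) s = count_mem (u.+1, u) s'.
  elim: u => [|u [IH1 IH2]].
    by have := eq1 (pred1 0); have := eq2 (pred1 0); rewrite !count1 // !count2 //=; lia.
  have := eq1 (pred1 u.+1); have := eq2 (pred1 u.+1).
  rewrite !count1 ?count2 //=.
  by rewrite !mul1n IH1 IH2 => /addIn-> /addIn->.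
apply/allP => -[a b]; rewrite mem_cat /= => ab_s; apply/eqP.
have: adjacent (a, b) by case/orP: ab_s; apply/allP.
by case/orP => /= /eqP->; have [] := main a; have [] := main b.
Qed.

Lemma udr_pkE p : permutation p ->
  udr_pk p = ((alternations true p).+1, (alternations false p)./2).
Proof.
move=> perm_p; rewrite /udr_pk udrE // pkE //.
exact: uniq_neq_sorted (andP perm_p).1.
Qed.

Lemma alternations_adjacent w : 1 < size w ->
  adjacent (alternations true w, alternations false w).
Proof.
case: w => [|a [|b w]] // _; rewrite /alternations /=.
by case: (a < b); rewrite /adjacent /= ?add0n ?add1n eqxx ?orbT.
Qed.

Lemma alternations_small w : size w <= 1 -> forall e, alternations e w = 0.
Proof. by case: w => [|a [|b w]]. Qed.

(** The initial step agrees with exactly one of the two initial directions, so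
    that for words of length at least 2 the two numbers of changes are
    adjacent; the second is thus known from the first and its own half. *)
Lemma udr_pk_shuffle_compatible : shuffle_compatible udr_pk.
Proof.
split.
  apply: (statistic_steps (F := fun _ s => ((count id (pairmap addb true s)).+1,
                                       (count id (pairmap addb false s))./2))).
  exact: udr_pkE.
have alt_inj w w' : permutation w -> permutation w' -> size w = size w' ->
    udr_pk w = udr_pk w' -> forall e, alternations e w = alternations e w'.
  move=> perm_w perm_w' size_w; rewrite !udr_pkE // => -[alt1 alt2] e.
  case: (leqP (size w) 1) => [small|large]; first by rewrite !alternations_small -?size_w.
  have := alternations_adjacent large.
  rewrite size_w in large; have := alternations_adjacent large.
  by rewrite /adjacent /=; case: e => //; lia.
move=> p p' q q' perm_p perm_p' perm_q perm_q' size_p size_q disj disj'.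
move=> /(alt_inj _ _ perm_p perm_p' size_p) alt_p /(alt_inj _ _ perm_q perm_q' size_q) alt_q.
pose alts t := (alternations true t, alternations false t).
have mapE r1 r2 : permutation r1 -> permutation r2 -> ~~ has [in r1] r2 ->
    [seq udr_pk t | t <- Sh r1 r2] =
    [seq (d.1.+1, d.2./2) | d <- [seq alts t | t <- Sh r1 r2]].
  move=> perm_r1 perm_r2 disj_r; rewrite -map_comp; apply/eq_in_map => t.
  by move/(permutation_Sh perm_r1 perm_r2 disj_r)/udr_pkE.
rewrite !mapE //; apply: perm_map.
have perm_alts e := perm_eq_Sh_alternations perm_p perm_p' perm_q perm_q' size_p size_q
  disj disj' (alt_p e) (alt_q e).
case: (leqP (size p + size q) 1) => [small | large].
  have constE r1 r2 : size r1 = size p -> size r2 = size q ->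
      [seq alts t | t <- Sh r1 r2] = nseq (size (Sh r1 r2)) (0, 0).
    move=> size_r1 size_r2; rewrite -(size_map alts); apply/all_pred1P/allP => _ /mapP[t t_Sh ->].
    by rewrite /= /alts !alternations_small // (size_Sh_mem t_Sh) size_r1 size_r2.
  rewrite !constE //; have := perm_size (perm_alts true).
  by rewrite !size_map => ->.
have adj r1 r2 : size r1 = size p -> size r2 = size q ->
    all adjacent [seq alts t | t <- Sh r1 r2].
  move=> size_r1 size_r2; apply/allP => _ /mapP[t t_Sh ->].
  by apply: alternations_adjacent; rewrite (size_Sh_mem t_Sh) size_r1 size_r2.
by apply: perm_eq_adjacent; rewrite ?adj // /unzip1 /unzip2 -!map_comp perm_alts.
Qed.

Theorem theorem6p2 :
  [/\ shuffle_compatible lpk,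
      shuffle_compatible rpk,
      shuffle_compatible epk,
      shuffle_compatible udr
    & shuffle_compatible udr_pk].
Proof.
split; [exact: lpk_shuffle_compatible | exact: rpk_shuffle_compatible | exact: epk_shuffle_compatible
       | exact: udr_shuffle_compatible | exact: udr_pk_shuffle_compatible].
Qed.
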